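(* Let $d,k$ be positive integers and $\lambda>0$. If the independent sets of $\mathbb{T}_{k,d}$ with activity $\lambda$ exhibit weak spatial mixing with rate $\delta(\cdot)$, then they also exhibit strong spatial mixing with rate $\frac{(1+\lambda)(\lambda+(1+k\lambda)^{d+1})}{\lambda}\delta(\cdot)$.
   Context: $\mathbb{T}_{k,d}$ is the infinite $(k+1)$-uniform $(d+1)$-regular hypertree (incidence graph is the infinite tree with vertex-nodes of degree $d+1$ and hyperedge-nodes of degree $k+1$). Independent sets: vertex sets meeting each hyperedge in at most one vertex; on a finite vertex set the Gibbs measure is $\mu(I)\propto\lambda^{|I|}$. For a finite vertex set $\Psi$ of $\mathbb{T}_{k,d}$, consider the Gibbs measure on the independent sets of $\mathbb{T}_{k,d}$ contained in $\Psi$ (i.e. conditioned on the vertices outside $\Psi$ adjacent to $\Psi$ being unoccupied), and for $v\in\Psi$, $\Lambda\subseteq\Psi$, $\sigma_\Lambda\in\{0,1\}^\Lambda$, let $p_v^{\sigma_\Lambda}$ be the conditional probability that $v$ is occupied given that the states on $\Lambda$ are $\sigma_\Lambda$. Weak spatial mixing (WSM) with rate $\delta$: for every finite $\Psi$, all $v,\Lambda$ and $\sigma_\Lambda,\tau_\Lambda$, $|p_v^{\sigma_\Lambda}-p_v^{\tau_\Lambda}|\le\delta(\mathrm{dist}(v,\Lambda))$. Strong spatial mixing (SSM) with rate $\delta$: the same with $\mathrm{dist}(v,\Lambda)$ replaced by $\mathrm{dist}(v,\Delta)$, where $\Delta\subseteq\Lambda$ is the set where $\sigma_\Lambda,\tau_\Lambda$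 differ. Distances are shortest-path distances in $\mathbb{T}_{k,d}$ (vertices adjacent iff they share a hyperedge). *)

(* Defs.v *)
From HB Require Import structures.
From mathcomp Require Import all_boot all_order all_algebra.
From mathcomp Require Import finmap boolp reals.

Set Implicit Arguments.
Unset Strict Implicit.
Unset Printing Implicit Defensive.

Import Order.TTheory GRing.Theory Num.Theory.
Local Open Scope fset_scope.
Local Open Scope ring_scope.

(* A hypergraph on the (possibly infinite) vertex type V is given by its set
   E of hyperedges, which are finite sets of vertices. *)
Section Hypergraph.
Variables (V : choiceType) (E : pred {fset V}).

Definition incidence (x y : V + {e : {fset V} | E e}) : bool :=
  match x, y with
  | inl v, inr e | inr e, inl v => v \in val e
  | _, _ => false
  end.

Definition uniform (m : nat) : Prop := forall e, E e -> #|` e| = m.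

Definition regular (m : nat) : Prop :=
  forall v : V, exists2 A : {fset {fset V}},
    #|` A| = m & forall e, (e \in A) = E e && (v \in e).

Definition adjacent (u v : V) : bool :=
  (u != v) && `[< exists e, [/\ E e, u \in e & v \in e] >].

(* The distance from v to the set S is n; for no n does this hold when S is
   empty (distance +oo). *)
Definition is_dist (v : V) (S : {fset V}) (n : nat) : Prop :=
  (exists p, [/\ path adjacent v p, last v p \in S & size p = n]) /\
  (forall p, path adjacent v p -> last v p \in S -> (n <= size p)%N).

Definition independent (I : {fset V}) : bool :=
  `[< forall e, E e -> (#|` I `&` e| <= 1)%N >].

End Hypergraph.

(* [ucycle] also holds of the degenerate closed walks x, y, x along a single
   edge; these are the sequences of size 2. *)
Definition is_tree (T : eqType) (r : rel T) : Prop :=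
  (forall x y, exists2 p, path r x p & last x p = y) /\
  (forall c, ucycle r c -> (size c < 3)%N).

(* E is the hyperedge set of a copy of T_{k,d}, which is determined up to
   isomorphism by these properties. *)
Record is_hypertree (V : choiceType) (k d : nat) (E : pred {fset V}) : Prop :=
  IsHypertree {
    hypertree_infinite : forall A : {fset V}, exists v, v \notin A;
    hypertree_uniform : uniform E k.+1;
    hypertree_regular : regular E d.+1;
    hypertree_tree : is_tree (@incidence V E)
  }.

Section Gibbs.
Variables (R : realType) (V : choiceType) (E : pred {fset V}) (lambda : R).

Definition weight (Psi : {fset V}) (P : pred {fset V}) : R :=
  \sum_(I <- fpowerset Psi | independent E I && P I) lambda ^+ #|` I|.

Definition gibbs (Psi : {fset V}) (P : pred {fset V}) : R :=
  weight Psi P / weight Psi predT.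

Definition agrees (L : {fset V}) (sigma : {ffun L -> bool}) : pred {fset V} :=
  fun I => [forall u : L, (val u \in I) == sigma u].

Definition feasible (Psi L : {fset V}) (sigma : {ffun L -> bool}) : Prop :=
  0 < gibbs Psi (agrees sigma).

Definition cond_prob (Psi : {fset V}) (v : V) (L : {fset V})
    (sigma : {ffun L -> bool}) : R :=
  gibbs Psi (fun I => (v \in I) && agrees sigma I) / gibbs Psi (agrees sigma).

Definition differ (L : {fset V}) (sigma tau : {ffun L -> bool}) : {fset V} :=
  [fset val u | u : L & sigma u != tau u].

(* In both definitions only boundary conditions of positive probability are
   considered, as conditioning on the others is undefined. *)
Definition WSM (delta : nat -> R) : Prop :=
  forall (Psi : {fset V}) (v : V) (L : {fset V}) (sigma tau : {ffun L -> bool})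
    (n : nat),
  v \in Psi -> L `<=` Psi -> feasible Psi sigma -> feasible Psi tau ->
  is_dist E v L n ->
  `|cond_prob Psi v sigma - cond_prob Psi v tau| <= delta n.

Definition SSM (delta : nat -> R) : Prop :=
  forall (Psi : {fset V}) (v : V) (L : {fset V}) (sigma tau : {ffun L -> bool})
    (n : nat),
  v \in Psi -> L `<=` Psi -> feasible Psi sigma -> feasible Psi tau ->
  is_dist E v (differ sigma tau) n ->
  `|cond_prob Psi v sigma - cond_prob Psi v tau| <= delta n.

End Gibbs.

(* Main.v *)
(* Conditioning on the part of the boundary where sigma and tau agree amounts
   to deleting vertices from Psi: the unoccupied ones, and the occupied ones
   together with their neighbours.  Since WSM quantifies over every finite
   region, applying it to the remaining region and the boundary
   [differ sigma tau] gives SSM with the same rate delta, and the constant in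
   the statement is at least 1. *)
Require Import Defs.
From mathcomp Require Import all_boot all_order all_algebra.
From mathcomp Require Import finmap boolp reals.

Set Implicit Arguments.
Unset Strict Implicit.
Unset Printing Implicit Defensive.

Import Order.TTheory GRing.Theory Num.Theory.
Local Open Scope ring_scope.

(** * Boundary conditions encoded by their sets of occupied vertices *)

Section Configurations.
Local Open Scope fset_scope.
Context {V : choiceType}.
Implicit Types (D L I J : {fset V}).

Definition occupied {L} (sigma : {ffun L -> bool}) : {fset V} :=
  [fset val u | u : L & sigma u].

Definition restrict {D L} (DL : D `<=` L) (sigma : {ffun L -> bool}) :
    {ffun D -> bool} :=
  [ffun u => sigma (fincl DL u)].

Lemma in_occupied L (sigma : {ffun L -> bool}) (u : L) :
  (val u \in occupied sigma) = sigma u.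
Proof.
apply/imfsetP/idP => [[w /= sw /val_inj ->] | su]; first by move: sw; rewrite inE.
by exists u; rewrite //= inE.
Qed.

Lemma occupied_sub L (sigma : {ffun L -> bool}) : occupied sigma `<=` L.
Proof. by apply/fsubsetP => x /imfsetP [u /= _ ->]; apply: valP. Qed.

Lemma agreesE L (sigma : {ffun L -> bool}) I :
  agrees sigma I = (I `&` L == occupied sigma).
Proof.
apply/forallP/eqP => [agr | eqI u].
  apply/fsetP => x; rewrite in_fsetI.
  have [xL | xL] := boolP (x \in L).
    by rewrite andbT -[x]/(val [` xL]) in_occupied; apply/eqP/agr.
  by rewrite andbF; apply/esym/negbTE; apply: contra xL; apply/fsubsetP/occupied_sub.
by rewrite -in_occupied -eqI in_fsetI (valP u) andbT.
Qed.

Lemma occupied_restrict D L (DL : D `<=` L) (sigma : {ffun L -> bool}) :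
  occupied (restrict DL sigma) = occupied sigma `&` D.
Proof.
apply/fsetP => x; rewrite in_fsetI.
have [xD | xD] := boolP (x \in D).
  by rewrite andbT -[x]/(val [` xD]) in_occupied ffunE -in_occupied.
by rewrite andbF; apply/negbTE; apply: contra xD; apply/fsubsetP/occupied_sub.
Qed.

Lemma differ_sub L (sigma tau : {ffun L -> bool}) : differ sigma tau `<=` L.
Proof. by apply/fsubsetP => x /imfsetP [u /= _ ->]; apply: valP. Qed.

(** Stated for every [x]: outside [L] both sides are false, so later set computations need no
    membership proof. *)
Lemma in_differ L (sigma tau : {ffun L -> bool}) x :
  (x \in differ sigma tau) = ((x \in occupied sigma) != (x \in occupied tau)).
Proof.
have [xL | xL] := boolP (x \in L).
  rewrite -[x]/(val [` xL]) !in_occupied.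
  apply/imfsetP/idP => [[w sw /val_inj ->] | su]; first by move: sw; rewrite inE.
  by exists [` xL]; rewrite //= inE.
have notin A : A `<=` L -> (x \in A) = false.
  by move/fsubsetP => AL; apply: contraNF xL => /AL.
by rewrite !notin ?occupied_sub ?differ_sub.
Qed.

End Configurations.

(** * Deleting the vertices whose state is forced by part of the boundary *)

Section Pruning.
Local Open Scope fset_scope.
Context {R : realType} {V : choiceType} (E : pred {fset V}) (lambda : R).
Implicit Types (D F L I J Psi : {fset V}) (P Q : pred {fset V}).

(** Two distinct points of [I] in a common hyperedge are exactly an adjacent pair, so independence
    depends only on the graph [adjacent E]. *)
Lemma independentP I :
  reflect {in I &, forall x y, ~~ adjacent E x y} (independent E I).
Proof.
apply: (iffP (asboolP _)) => [ind x y xI yI | nadj e Ee].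
  apply/negP => /andP [neq_xy /asboolP [e [Ee xe ye]]].
  have: [fset x; y] `<=` I `&` e.
    by apply/fsubsetP => z /fset2P [] ->; rewrite in_fsetI ?xI ?yI ?xe ?ye.
  by move/fsubset_leq_card; rewrite cardfs2 neq_xy leqNgt ltnS ind.
rewrite leqNgt; apply/negP => /[dup] /ltnW; rewrite cardfs_gt0 => /fset0Pn [x].
rewrite in_fsetI => /andP [xI xe].
rewrite (cardfsD1 x) in_fsetI xI xe ltnS cardfs_gt0 => /fset0Pn [y].
rewrite in_fsetD1 in_fsetI => /and3P [neq_yx yI ye].
have /negP := nadj y x yI xI; apply.
by rewrite /adjacent neq_yx; apply/asboolP; exists e.
Qed.

Lemma independentS I J : I `<=` J -> independent E J -> independent E I.
Proof.
move=> /fsubsetP IJ /independentP ind; apply/independentP => x y xI yI.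
by apply: ind; apply: IJ.
Qed.

Lemma adjacentC x y : adjacent E x y = adjacent E y x.
Proof.
rewrite /adjacent eq_sym; congr (_ && _).
by apply/asboolP/asboolP => -[e [Ee xe ye]]; exists e.
Qed.

(** Used with [L \ D] for the fixed vertices and [occupied sigma \ D] for the occupied ones among
    them; the latter lie in the former, so they are deleted along with their neighbours. *)
Definition remaining Psi D F : {fset V} :=
  [fset x in Psi | (x \notin D) && [forall u : F, ~~ adjacent E (val u) x]].

Lemma in_remaining Psi D F x :
  reflect [/\ x \in Psi, x \notin D & {in F, forall u, ~~ adjacent E u x}]
          (x \in remaining Psi D F).
Proof.
rewrite !inE; apply: (iffP and3P) => [] [xP xD nadj]; split=> //.
  by move=> u uF; have /forallP /(_ [` uF]) := nadj.
by apply/forallP => u; apply/nadj/valP.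
Qed.

Lemma weight_gt0_witness Psi P :
  0 < weight E lambda Psi P ->
  exists I, [/\ I `<=` Psi, independent E I & P I].
Proof.
move=> gt0; have [I IP /andP [indI PI]] : exists2 I,
    I \in fpowerset Psi & independent E I && P I.
  apply/hasP; apply: contraLR gt0 => /hasPn none.
  by rewrite /weight big_seq_cond big1 ?ltxx // => I /andP [/none /negP].
by exists I; split=> //; rewrite -fpowersetE.
Qed.

Context {D L Psi : {fset V}} (DL : D `<=` L) (LPsi : L `<=` Psi).
Context (sigma : {ffun L -> bool}).
Local Notation F := (occupied sigma `\` D).
Local Notation Psi' := (remaining Psi (L `\` D) F).

(** Outside [D], [sigma] forces [F] to be occupied and the rest of [L] empty, and independence then
    empties the neighbours of [F]; what is left free is a set [J] in [Psi']. *)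
Lemma pruned_configurations I :
  independent E (occupied sigma) -> D `<=` Psi' ->
  (exists J, [/\ J `<=` Psi', independent E J, agrees (restrict DL sigma) J
               & I = F `|` J]) <->
  [/\ I `<=` Psi, independent E I & agrees sigma I].
Proof.
move=> /independentP ind /fsubsetP DP; have /fsubsetP sL := occupied_sub sigma.
split=> [[J [/fsubsetP JP /independentP indJ agr ->]] |
         [/fsubsetP IP /independentP indI agr]].
  move: agr; rewrite agreesE occupied_restrict => /eqP /fsetP agr.
  split.
  - apply/fsubsetP => x /fsetUP [/fsetDP [/sL /(fsubsetP LPsi)] // | /JP].
    by case/in_remaining.
  - apply/independentP => x y /fsetUP [xF | xJ] /fsetUP [yF | yJ].
    + by move: xF yF => /fsetDP [xs _] /fsetDP [ys _]; apply: ind.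
    + by have /JP /in_remaining [_ _] := yJ; apply.
    + by rewrite adjacentC; have /JP /in_remaining [_ _] := xJ; apply.
    + exact: indJ.
  (* On [D] agreement comes from [J], as [F] misses [D]; off [D] it comes from [F], as [J] misses
     [L \ D]. *)
  - rewrite agreesE; apply/eqP/fsetP => x; rewrite !inE.
    have := agr x; rewrite !inE.
    have [xD | xD] /= := boolP (x \in D); first by rewrite (fsubsetP DL x xD) !andbT.
    move=> _; have [xJ | xJ] := boolP (x \in J).
      have /JP /in_remaining [_] := xJ; rewrite !inE xD /= => /negbTE xL _.
      by rewrite xL andbF; apply/esym; apply: contraFF xL => /sL.
    by rewrite orbF; apply: andb_idr => /sL.
move: agr; rewrite agreesE => /eqP /fsetP agr.
have sI x : x \in occupied sigma -> x \in I by rewrite -agr inE => /andP [].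
exists (I `\` F); split.
- apply/fsubsetP => x /fsetDP [xI xF]; apply/in_remaining; split; first exact: IP.
    apply: contra xF => /fsetDP [xL xD]; rewrite !inE xD -agr !inE xI xL //.
  by move=> u /fsetDP [/sI uI _]; apply: indI.
- apply: (@independentS _ I); first exact: fsubsetDl.
  exact/independentP.
- rewrite agreesE occupied_restrict; apply/eqP/fsetP => x.
  have := agr x; rewrite !inE; have [xD|] /= := boolP (x \in D); last by rewrite !andbF.
  by rewrite (fsubsetP DL x xD) !andbT.
- apply/fsetP => x; rewrite !inE.
  have := @sI x; case: (x \in occupied sigma) => //= [-> //|_]; last by rewrite andbF.
  by rewrite !andbT orbN.
Qed.

(** The map from [J] to the union of [F] and [J] is a bijection between the two families, and
    disjointness makes it multiply weights by [lambda ^+ #|F|]. *)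
Lemma weight_prune Q :
  independent E (occupied sigma) -> D `<=` Psi' ->
  weight E lambda Psi (fun I => Q I && agrees sigma I) =
  lambda ^+ #|` F| * weight E lambda Psi'
    (fun J => Q (F `|` J) && agrees (restrict DL sigma) J).
Proof.
move=> ind DP; rewrite /weight mulr_sumr.
have disj J : J \in fpowerset Psi' -> agrees (restrict DL sigma) J -> [disjoint F & J].
  rewrite fpowersetE => /fsubsetP JP agr; apply/fdisjointP => x /fsetDP [xs xD].
  apply/negP => /JP /in_remaining [_]; rewrite !inE xD /= => /negP [].
  exact: (fsubsetP (occupied_sub sigma)).
(* Removing [F] undoes the map, which gives its injectivity below. *)
have keep J : J \in fpowerset Psi' -> agrees (restrict DL sigma) J -> J `\` F = J.
  by move=> JP aJ; apply/fsetDidPl; rewrite fdisjoint_sym disj.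
rewrite -big_filter -[RHS]big_filter.
pose s' := [seq J <- fpowerset Psi' | independent E J &
              Q (F `|` J) && agrees (restrict DL sigma) J].
rewrite -/s' (perm_big [seq F `|` J | J <- s']) /=; last first.
  apply: uniq_perm.
  - exact/filter_uniq/fset_uniq.
  - rewrite map_inj_in_uniq ?filter_uniq ?fset_uniq // => J1 J2.
    rewrite !mem_filter => /andP [/and3P [_ _ a1] P1] /andP [/and3P [_ _ a2] P2].
    move=> /(congr1 (fun X => X `\` F)); rewrite !fsetDUl fsetDv !fset0U.
    by rewrite !keep.
  - move=> I; rewrite mem_filter; apply/idP/mapP.
      move=> /andP [/and3P [indI QI aI]]; rewrite fpowersetE => IP.
      have [|J [JP indJ aJ eI]] := (pruned_configurations I ind DP).2; first by [].
      by exists J; rewrite // mem_filter indJ -eI QI aJ fpowersetE.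
    move=> [J]; rewrite mem_filter => /andP [/and3P [indJ QJ aJ]].
    rewrite fpowersetE => JP ->; rewrite QJ fpowersetE /=.
    have [|-> -> ->//] := (pruned_configurations (F `|` J) ind DP).1.
    by exists J.
rewrite big_map big_seq [RHS]big_seq; apply: eq_bigr => J.
rewrite mem_filter => /andP [/and3P [_ _ aJ] JP]; rewrite -exprD cardfsU.
by have /eqP -> := disj J JP aJ; rewrite cardfs0 subn0.
Qed.

(** * Positivity of weights and pruned conditional probabilities *)

Context (lambda_gt0 : 0 < lambda).

Lemma weight_gt0 (X I : {fset V}) P :
  I `<=` X -> independent E I -> P I -> 0 < weight E lambda X P.
Proof.
rewrite -fpowersetE => IX indI PI; rewrite /weight (big_rem I) //= indI PI.
by rewrite ltr_wpDr ?exprn_gt0 // sumr_ge0 // => J _; apply/exprn_ge0/ltW.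
Qed.

Lemma partition_function_gt0 (X : {fset V}) : 0 < weight E lambda X predT.
Proof.
apply: (@weight_gt0 _ fset0) => //.
by apply/independentP => x y; rewrite inE.
Qed.

Lemma feasibleE (X M : {fset V}) (rho : {ffun M -> bool}) :
  feasible E lambda X rho <-> 0 < weight E lambda X (agrees rho).
Proof. by rewrite /feasible /gibbs pmulr_lgt0 ?invr_gt0 ?partition_function_gt0. Qed.

Lemma cond_probE (X M : {fset V}) (v : V) (rho : {ffun M -> bool}) :
  cond_prob E lambda X v rho =
  weight E lambda X (fun I => (v \in I) && agrees rho I) /
  weight E lambda X (agrees rho).
Proof.
rewrite /cond_prob /gibbs invf_div mulrA divfK //.
exact/lt0r_neq0/partition_function_gt0.
Qed.

(** Positive weight yields an independent set agreeing with [rho], and [occupied rho] is a subset of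
    it. *)
Lemma feasible_independent (X M : {fset V}) (rho : {ffun M -> bool}) :
  feasible E lambda X rho -> independent E (occupied rho).
Proof.
move/feasibleE/weight_gt0_witness => [I [_ indI]]; rewrite agreesE => /eqP <-.
by apply: independentS indI; apply: fsubsetIl.
Qed.

Context (feas : feasible E lambda Psi sigma) (DP : D `<=` Psi').

Lemma weight_prune_agrees :
  weight E lambda Psi (agrees sigma) =
  lambda ^+ #|` F| * weight E lambda Psi' (agrees (restrict DL sigma)).
Proof. exact: (weight_prune predT (feasible_independent feas) DP). Qed.

Lemma feasible_prune : feasible E lambda Psi' (restrict DL sigma).
Proof.
move/feasibleE: feas; rewrite weight_prune_agrees pmulr_rgt0 ?exprn_gt0 //.
by move=> ?; apply/feasibleE.
Qed.

(** The factor [lambda ^+ #|F|] cancels in the quotient. A deleted vertex has a forced state: it is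
    occupied exactly when it lies in [F]. *)
Lemma cond_prob_prune v :
  cond_prob E lambda Psi v sigma =
  if v \in Psi' then cond_prob E lambda Psi' v (restrict DL sigma)
  else (v \in F)%:R.
Proof.
have W_neq0 := lt0r_neq0 ((feasibleE _ _).1 feasible_prune).
have lam_neq0 : lambda ^+ #|` F| != 0 by rewrite lt0r_neq0 ?exprn_gt0.
rewrite !cond_probE weight_prune_agrees.
rewrite (weight_prune (fun I => v \in I) (feasible_independent feas) DP).
rewrite -mulf_div divff // mul1r.
case: ifPn => vP.
  congr (_ / _); apply: eq_bigl => J; rewrite in_fsetU.
  case/in_remaining: vP => _ vLD _.
  suff /negbTE -> : v \notin F by [].
  apply: contra vLD => /fsetDP [vs vD].
  by rewrite !inE vD (fsubsetP (occupied_sub sigma)).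
suff -> : weight E lambda Psi'
      (fun J => (v \in F `|` J) && agrees (restrict DL sigma) J) =
    (v \in F)%:R * weight E lambda Psi' (agrees (restrict DL sigma)).
  by rewrite mulfK.
(* No [J] in [Psi'] contains the deleted [v], so the event is constant over the sum. *)
have eqF J : J \in fpowerset Psi' -> (v \in F `|` J) = (v \in F).
  rewrite fpowersetE in_fsetU => /fsubsetP JP.
  by rewrite (contraNF (JP v) vP) orbF.
rewrite /weight big_seq_cond (eq_bigl (fun J => (J \in fpowerset Psi') &&
    (independent E J && ((v \in F) && agrees (restrict DL sigma) J)))); last first.
  by move=> J; apply: andb_id2l => /eqF ->.
rewrite -big_seq_cond; case: (v \in F); rewrite ?mul1r ?mul0r //.
by apply: big_pred0 => J; rewrite andbF.
Qed.

End Pruning.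

(** * From weak to strong spatial mixing *)

Section Spatial.
Local Open Scope fset_scope.
Context (R : realType) (V : choiceType) (E : pred {fset V}) (lambda : R).
Context (lambda_gt0 : 0 < lambda).

(** Compare the everywhere unoccupied boundary, which is always feasible, with itself. *)
Lemma WSM_rate_ge0 (delta : nat -> R) (Psi L : {fset V}) (v : V) n :
  WSM E lambda delta -> v \in Psi -> L `<=` Psi -> is_dist E v L n -> 0 <= delta n.
Proof.
move=> wsm vP LP dist; pose empty := [ffun _ : L => false].
have feas : feasible E lambda Psi empty.
  apply/(feasibleE _ lambda_gt0)/(weight_gt0 lambda_gt0 (I := fset0)).
  - exact: fsub0set.
  - by apply/independentP => x y; rewrite inE.
  - by apply/forallP => u; rewrite ffunE inE.
by have := wsm Psi v L empty empty n vP LP feas feas dist; rewrite subrr normr0.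
Qed.

(** Guarantees that [sigma] and [tau] prune [Psi] to the same region. *)
Lemma occupied_off_differ (L : {fset V}) (sigma tau : {ffun L -> bool}) :
  occupied sigma `\` differ sigma tau = occupied tau `\` differ sigma tau.
Proof.
by apply/fsetP => x; rewrite !inE in_differ; case: (x \in occupied sigma); case: (x \in _).
Qed.

Lemma WSM_SSM (delta : nat -> R) : WSM E lambda delta -> SSM E lambda delta.
Proof.
move=> wsm Psi v L sigma tau n vP LP fs ft dist.
have delta_ge0 : 0 <= delta n.
  exact: WSM_rate_ge0 wsm vP (fsubset_trans (differ_sub sigma tau) LP) dist.
set D := differ sigma tau in dist *; have DL : D `<=` L := differ_sub sigma tau.
have eqF : occupied sigma `\` D = occupied tau `\` D := occupied_off_differ sigma tau.
(* The disagreement set survives pruning: each [x] in [D] is occupied under one of [sigma], [tau],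
   while [u] is occupied under both, so independence of that one keeps [x] and [u] non-adjacent. *)
have DP : D `<=` remaining E Psi (L `\` D) (occupied sigma `\` D).
  apply/fsubsetP => x xD; apply/in_remaining; split.
  - exact/(fsubsetP LP)/(fsubsetP DL).
  - by rewrite inE xD.
  move=> u uF; have uF' : u \in occupied tau `\` D by rewrite -eqF.
  move: uF uF' => /fsetDP [us _] /fsetDP [ut _].
  have /independentP indS := feasible_independent lambda_gt0 fs.
  have /independentP indT := feasible_independent lambda_gt0 ft.
  have [xs|xs] := boolP (x \in occupied sigma); first exact: indS.
  apply: indT => //; move: xD; rewrite in_differ (negbTE xs).
  by case: (x \in occupied tau).
have DP' := DP; rewrite eqF in DP'.
rewrite (cond_prob_prune DL LP lambda_gt0 fs DP) (cond_prob_prune DL LP lambda_gt0 ft DP').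
(* If [v] is deleted, both probabilities are the same forced value. Otherwise weak mixing applies
   with the same [n], since distances are taken in the whole hypergraph and not in the region. *)
rewrite -eqF; case: ifP => [vP' | _]; last by rewrite subrr normr0.
apply: wsm => //; first exact: feasible_prune fs DP.
by rewrite eqF; apply: feasible_prune ft DP'.
Qed.

End Spatial.

(** * Passing from the rate [delta] to its stated multiple *)

Theorem theorem16 (R : realType) (d k : nat) (lambda : R)
    (V : choiceType) (E : pred {fset V}) (delta : nat -> R) :
  (0 < d)%N -> (0 < k)%N -> 0 < lambda ->
  is_hypertree k d E ->
  WSM E lambda delta ->
  SSM E lambda
    (fun n => (1 + lambda) * (lambda + (1 + k%:R * lambda) ^+ d.+1) / lambda
              * delta n).
Proof.
move=> _ _ lambda_gt0 _ wsm Psi v L sigma tau n vP LP fs ft dist.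
have bound := WSM_SSM lambda_gt0 wsm vP LP fs ft dist.
(* [delta n] is nonnegative because it bounds an absolute value; it remains to see that the constant
   is at least 1. *)
apply: (le_trans bound); apply: ler_peMl; first exact: le_trans bound.
rewrite ler_pdivlMr // mul1r.
have pow_ge1 : 1 <= (1 + k%:R * lambda) ^+ d.+1.
  by rewrite exprn_ege1 // lerDl mulr_ge0 // ltW.
(* The second factor of the numerator already exceeds [lambda], and the first is at least 1. *)
rewrite (le_trans (y := lambda + (1 + k%:R * lambda) ^+ d.+1)) //.
  by rewrite lerDl (le_trans ler01).
rewrite ler_peMl ?lerDl ?ltW //.
by rewrite ltr_wpDr ?(le_trans ler01).
Qed.
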